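(* For every real number $c$ there exists a constant $C_c>0$ depending only on $c$ such that the following holds. Let $u:[0,1]^2\to\mathbb{R}$ be continuous on $[0,1]^2$ and twice continuously differentiable on $(0,1)^2$, with $1\le \Delta u\le c$ on $(0,1)^2$. Then for all $\alpha>0$ and all $\varepsilon>0$, $$\left|\left\{x\in[0,1]^2: |u(x)|\le \varepsilon\right\}\right| \le C_c\left(\sqrt{\varepsilon} + (2\varepsilon)^{\alpha-\frac12}\int_{[0,1]^2}\frac{|\nabla u(x)|}{|u(x)|^{\alpha}}\,dx\right).$$
   Context: $|\cdot|$ applied to a set denotes two-dimensional Lebesgue measure, $\nabla u$ is the gradient, $|\nabla u|$ its Euclidean norm, and $\Delta u=\partial_{x_1}^2u+\partial_{x_2}^2u$ is the Laplacian. The integral is of a nonnegative function and is allowed to equal $+\infty$, in which case the inequality is trivially true. *)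

(* Defs.v *)
From mathcomp Require Export all_boot all_order all_algebra.
From mathcomp Require Export all_classical all_reals all_analysis.

Set Implicit Arguments.
Unset Strict Implicit.
Unset Printing Implicit Defensive.

Export Order.TTheory GRing.Theory Num.Theory.
Export numFieldNormedType.Exports.

Local Open Scope classical_set_scope.
Local Open Scope ring_scope.

(* The plane is modelled by the product R * R. The library norm on R * R is the
   sup norm, so the Euclidean norm of the gradient is written out below. *)

Definition square {R : realType} : set (R * R) :=
  [set` `[0, 1]%R] `*` [set` `[0, 1]%R].

Definition open_square {R : realType} : set (R * R) :=
  [set` `]0, 1[%R] `*` [set` `]0, 1[%R].

Definition partial1 {R : realType} (u : R * R -> R) : R * R -> R :=
  fun x => 'D_((1, 0) : R * R) u x.

Definition partial2 {R : realType} (u : R * R -> R) : R * R -> R :=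
  fun x => 'D_((0, 1) : R * R) u x.

(* Meant for U open: only then do derivability and continuity at the points of U
   depend on the values of u in U alone. *)
Definition C1 {R : realType} (U : set (R * R)) (u : R * R -> R) : Prop :=
  forall x : R * R, U x ->
    [/\ derivable u x (1, 0), derivable u x (0, 1),
        {for x, continuous (partial1 u)} & {for x, continuous (partial2 u)}].

Definition C2 {R : realType} (U : set (R * R)) (u : R * R -> R) : Prop :=
  [/\ C1 U u, C1 U (partial1 u) & C1 U (partial2 u)].

Definition gradient_norm {R : realType} (u : R * R -> R) (x : R * R) : R :=
  Num.sqrt (partial1 u x ^+ 2 + partial2 u x ^+ 2).

Definition laplacian {R : realType} (u : R * R -> R) (x : R * R) : R :=
  partial1 (partial1 u) x + partial2 (partial2 u) x.

(* Defined on the Borel sigma-algebra of the plane. *)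
Definition lebesgue2 {R : realType} :=
  (@lebesgue_measure R \x @lebesgue_measure R)%E.

(* Main.v *)
Require Import Defs.
From mathcomp Require Import ring lra measurable_realfun.

(** Why the theorem holds.  Since alpha > 0, the factor |u|^(-alpha) is at
    least (2 eps)^(-alpha) where |u| <= 2 eps, so it suffices to bound the area
    of {|u| <= eps} by sqrt(eps) plus eps^(-1/2) times the integral of the
    gradient over {|u| <= 2 eps}.  For eps >= 1 the first term exceeds the area
    of the square.  For eps < 1 the square is cut into cells of side s close to
    sqrt(eps), and it is enough to bound the area of {|u| <= eps} in one cell
    by a multiple of 1/s times the integral of the gradient over the part of
    that cell where |u| <= 2 eps ([cell_estimate]).

    Fix a cell and a small threshold tau, a fixed multiple of s^2.  A horizontal
    or vertical line through the cell is called bad when the integral of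
    |d_i u| over the part of the line where |u| <= 2 eps is at least tau.  By
    Tonelli and Markov the bad lines have measure at most 1/tau times the
    integral to be used ([markov_rows], [markov_columns]).  Along a good line,
    u moves by at most tau away from any value well inside [-2 eps, 2 eps],
    because to move further it would first have to spend variation tau while
    still in that range ([small_variation]).

    Suppose a point p with |u(p)| <= eps lies on two good lines.  Every other
    good line crosses one of these two, so u is within 2 tau of u(p) on all good
    lines.  If the bad lines have measure less than s/5 in each direction, then
    good lines can be chosen near the four sides of the cell and through its
    middle.  So u is nearly constant on the boundary of a rectangle and at
    a point x0 well inside it.  But Laplacian >= 1 forbids this: the maximum
    principle for u - |x - x0|^2 / 8 ([rectangle_maximum_principle]) shows that
    u(x0) lies below the maximum of u on the frame by a multiple of s^2
    ([no_small_value_on_good_lines]).  Hence {|u| <= eps} is covered by the bad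
    lines, unless these have measure at least s/5 in one direction, and then
    they already account for the whole cell. *)

Set Implicit Arguments.
Unset Strict Implicit.
Unset Printing Implicit Defensive.

Local Open Scope classical_set_scope.
Local Open Scope ring_scope.

(** * Measure and integration on the plane *)

(** An open set is the union of the boxes with rational end points that it
    contains. *)
Lemma open_measurable_plane (R : realType) (A : set (R * R)) :
  open A -> measurable A.
Proof.
move=> oA.
pose box (a b c d : rat) : set (R * R) :=
  `]ratr a, ratr b[%classic `*` `]ratr c, ratr d[%classic.
pose F a b c d := if `[< box a b c d `<=` A >] then box a b c d else set0.
rewrite (_ : A = \bigcup_a \bigcup_b \bigcup_c \bigcup_d F a b c d); last first.
  apply/seteqP; split=> [[x y] Axy|[x y]] /=; last first.
    move=> [a _ [b _ [c _ [d _]]]]; rewrite /F; case: asboolP => // H; exact: H.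
  have /nbhs_ballP[e /= e0 Be] : nbhs (x, y) A by exact: open_nbhs_nbhs.
  have xl : x - e < x by rewrite ltrBlDr ltrDl.
  have xr : x < x + e by rewrite ltrDl.
  have yl : y - e < y by rewrite ltrBlDr ltrDl.
  have yr : y < y + e by rewrite ltrDl.
  have [a] := rat_in_itvoo xl; have [b] := rat_in_itvoo xr.
  have [c] := rat_in_itvoo yl; have [d] := rat_in_itvoo yr.
  rewrite !in_itv /= => /andP[d1 d2] /andP[c1 c2] /andP[b1 b2] /andP[a1 a2].
  exists a => //; exists b => //; exists c => //; exists d => //.
  rewrite /F asboolT.
    by rewrite /box; split; rewrite /= in_itv /=; apply/andP; split.
  move=> [x' y'] [/=]; rewrite !in_itv /= => /andP[h1 h2] /andP[h3 h4].
  apply: Be; split; rewrite /ball /= ltr_norml; lra.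
do 4! (apply: bigcupT_measurable_rat => ?).
by rewrite /F; case: ifP => _; [apply: measurableX|exact: measurable0].
Qed.

Lemma continuous_measurable_plane (R : realType) (U : set (R * R)) (f : R * R -> R) :
  open U -> (forall x, U x -> {for x, continuous f}) -> measurable_fun U f.
Proof.
move=> oU cf; apply: (measurability _ (RGenOpens.measurableE R)).
move=> _ [_ [a [b ->] <-]]; apply: open_measurable_plane.
rewrite openE => x [Ux fx]; apply: filterI; first exact: open_nbhs_nbhs.
apply: (cf x Ux); apply: open_nbhs_nbhs; split => //; exact: interval_open.
Qed.

Lemma open_setX (T1 T2 : topologicalType) (A : set T1) (B : set T2) :
  open A -> open B -> open (A `*` B).
Proof.
move=> oA oB; rewrite openE => -[x y] [/= Ax By].
by exists (A, B) => //; split; exact: open_nbhs_nbhs.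
Qed.

Lemma lebesgue2X (R : realType) (X Y : set (measurableTypeR R)) : measurable X -> measurable Y ->
  lebesgue2 (X `*` Y) = (lebesgue_measure X * lebesgue_measure Y)%E.
Proof. by move=> mX mY; exact: product_measure1E. Qed.

(** Comparison of the simple functions below the two integrands, so that no
    measurability is required: the weighted gradient may fail to be measurable
    on the boundary of the square, where the partial derivatives depend on the
    values of the function outside the square. *)
Lemma ge0_le_integral_sub d (T : measurableType d) (R : realType)
    (mu : {measure set T -> \bar R}) (A B : set T) (f g : T -> \bar R) :
  A `<=` B -> (forall x, A x -> (0 <= f x)%E) -> (forall x, B x -> (0 <= g x)%E) ->
  (forall x, A x -> (f x <= g x)%E) ->
  (\int[mu]_(x in A) f x <= \int[mu]_(x in B) g x)%E.
Proof.
move=> AB f0 g0 fg; rewrite (ge0_integralE _ f0) (ge0_integralE _ g0).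
apply: le_ereal_sup => _ [h /= hf <-]; exists h => // x.
apply: (le_trans (hf x)); rewrite !patchE.
case: ifPn => [/set_mem Ax|_].
  by rewrite (mem_set (AB _ Ax)); exact: fg.
by case: ifPn => // /set_mem Bx; exact: g0.
Qed.

(** * Variation along a line *)

(** The level set {h = tau} is compact and nonempty, and its least element is
    the first exit: an earlier value above tau would, by the intermediate value
    theorem, produce an earlier point of the level set. *)
Lemma first_exit (R : realType) (h : R -> R) (tau : R) :
  {within `[0, 1], continuous h} -> h 0 <= tau -> tau <= h 1 ->
  exists2 r, r \in `[0, 1] & h r = tau /\ forall s, s \in `[0, r] -> h s <= tau.
Proof.
move=> ch h0 h1.
have exit x : x \in `[0, 1] -> tau <= h x ->
    exists2 r, r \in `[0, x] & h r = tau.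
  rewrite in_itv /= => /andP[x0 x1] hx; apply: IVT => //; last first.
    by rewrite ge_min h0 le_max hx orbT.
  apply: continuous_subspaceW ch; apply: subset_itvl; exact: x1.
pose A : set R := `[0, 1]%classic `&` h @^-1` [set tau].
have cA : compact A.
  have : closed (h @^-1` [set tau] : set (subspace `[0, 1]%classic)).
    by move/continuous_closedP : ch; apply; exact: closed_eq.
  move=> /closed_subspaceP[V cV VE]; rewrite /A setIC -VE setIC.
  by apply: compact_closedI => //; exact: segment_compact.
have A0 : A !=set0.
  have [|r r01 hr] := exit 1 _ h1; first by rewrite in_itv /= lexx ler01.
  by exists r.
have cid : {within A, continuous (@id R)}.
  by apply: continuous_subspaceT => x; exact: cvg_id.
have [r /set_mem [r01 hr] rmin] := compact_EVT_min A0 cA cid.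
exists r => //; split=> // s; rewrite in_itv /= => /andP[s0 sr].
rewrite leNgt; apply/negP => hs.
have /andP[r0 r1] : 0 <= r <= 1 by move: r01; rewrite /= in_itv.
have s1 : s \in `[0, 1] by rewrite in_itv /= s0 (le_trans sr).
have [q] := exit s s1 (ltW hs); rewrite in_itv /= => /andP[q0 qs] hq.
have : r <= q.
  apply: rmin; apply/mem_set; split => //=; rewrite in_itv /= q0.
  by rewrite (le_trans qs)// (le_trans sr).
move=> rq; have sE : s = q by apply/eqP; rewrite eq_le qs (le_trans sr)// .
by move: hs; rewrite sE hq ltxx.
Qed.

Lemma variation_le_integral (R : realType) (f : R -> R) (x y : R) :
  x <= y ->
  (forall t, t \in `[x, y] -> derivable f t 1) ->
  (forall t, t \in `[x, y] -> {for t, continuous (derive1 f)}) ->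
  (`|f y - f x|%:E <= \int[lebesgue_measure]_(t in `[x, y]) `|derive1 f t|%:E)%E.
Proof.
rewrite le_eqVlt => /orP[/eqP <- _ _|xy df cf].
  rewrite subrr normr0; apply: integral_ge0 => t _; exact: normr_ge0.
have fc t : t \in `[x, y] -> {for t, continuous f}.
  by move=> /df/derivable1_diffP/differentiable_continuous.
have cf' : {within `[x, y], continuous (derive1 f)}.
  by apply: continuous_in_subspaceT => t /set_mem; exact: cf.
have xin : x \in `[x, y] by rewrite in_itv /= lexx ltW.
have yin : y \in `[x, y] by rewrite in_itv /= lexx ltW.
have -> : `|f y - f x|%:E =
    `|\int[lebesgue_measure]_(t in `[x, y]) (derive1 f t)%:E|%E.
  rewrite (continuous_FTC2 (F := f) xy)//; split.
  - by move=> t txy; apply: df; apply: subset_itv_oo_cc.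
  - apply: cvg_at_right_filter; exact: fc.
  - apply: cvg_at_left_filter; exact: fc.
apply: le_abse_integral => //.
apply/measurable_EFinP; apply: subspace_continuous_measurable_fun => //.
Qed.

(** If f moved by more than tau between p and q, then up to the first point
    where it has moved by exactly tau it would satisfy |f| <= M, so that part
    of the path alone would contribute tau to the integral.  The path is parametrized
    by r in [0, 1] to treat p < q and q < p at once. *)
Lemma small_variation (R : realType) (f : R -> R) (a b tau M p q : R) :
  (forall t, t \in `]a, b[ -> derivable f t 1) ->
  (forall t, t \in `]a, b[ -> {for t, continuous (derive1 f)}) ->
  p \in `]a, b[ -> q \in `]a, b[ -> 0 <= tau -> `|f p| + tau <= M ->
  (\int[lebesgue_measure]_(t in `]a, b[)
     (if `|f t| <= M then `|derive1 f t| else 0)%:E < tau%:E)%E ->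
  `|f q - f p| <= tau.
Proof.
move=> df cf pab qab tau0 pM small; rewrite leNgt; apply/negP => far.
pose l r := p + r * (q - p).
have lab r : r \in `[0, 1] -> l r \in `]a, b[.
  move: pab qab; rewrite !in_itv /= /l => /andP[p1 p2] /andP[q1 q2] /andP[r0 r1].
  by have [pq|pq] := leP p q; apply/andP; split; nra.
have fc t : t \in `]a, b[ -> {for t, continuous f}.
  by move=> /df/derivable1_diffP/differentiable_continuous.
pose h r := `|f (l r) - f p|.
have ch : {within `[0, 1], continuous h}.
  apply: continuous_in_subspaceT => r /set_mem r01.
  apply: cvg_norm; apply: cvgB; last exact: cvg_cst.
  apply: (@continuous_comp _ _ _ l f); last exact/fc/lab.
  by apply: cvgD; [exact: cvg_cst|apply: cvgMl; exact: cvg_id].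
have h0 : h 0 <= tau by rewrite /h /l mul0r addr0 subrr normr0.
have h1 : tau <= h 1 by rewrite /h (_ : l 1 = q) ?ltW// /l; ring.
have [r r01 [hr hs]] := first_exit ch h0 h1.
have r0 : 0 <= r by move: r01; rewrite in_itv => /andP[].
have near_p t : (t \in `[Num.min p (l r), Num.max p (l r)]) ->
    (t \in `]a, b[) /\ (`|f t| <= M).
  move=> tI.
  have [s s0r ->] : exists2 s, s \in `[0, r] & t = l s.
    have [pq|pq] := eqVneq p q.
      exists 0; first by rewrite in_itv /= lexx.
      move: tI; rewrite /l pq subrr !mulr0 !addr0 minxx maxxx in_itv /=.
      by move=> /andP[? ?]; apply/eqP; rewrite eq_le; apply/andP.
    exists ((t - p) / (q - p)); last first.
      by rewrite /l divfK ?subr_eq0 1?eq_sym// addrC subrK.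
    move: tI; rewrite !in_itv /= /l.
    have [qp|qp|qp] := ltgtP p q; last by rewrite qp eqxx in pq.
    - have pos : 0 < q - p by rewrite subr_gt0.
      have lep : p <= p + r * (q - p) by rewrite lerDl mulr_ge0// ltW.
      rewrite min_l// max_r// => /andP[t1 t2].
      by rewrite divr_ge0 ?subr_ge0 ?(ltW qp) //= ler_pdivrMr// lerBlDl.
    - have neg : q - p < 0 by rewrite subr_lt0.
      have lep : p + r * (q - p) <= p by rewrite gerDl mulr_ge0_le0// ltW.
      rewrite min_r// max_l// => /andP[t1 t2].
      by rewrite ler_ndivrMr// ler_ndivlMr// mul0r subr_le0 t2 lerBrDl t1.
  have s01 : s \in `[0, 1].
    move: s0r r01; rewrite !in_itv /= => /andP[-> sr] /andP[_ r1].
    exact: le_trans r1.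
  split; first exact: lab.
  have := hs s s0r; rewrite /h => hsr.
  have := ler_normD (f (l s) - f p) (f p); rewrite subrK => /le_trans; apply.
  by rewrite addrC (le_trans _ pM)// lerD2l.
have : (tau%:E <= \int[lebesgue_measure]_(t in `]a, b[)
     (if `|f t| <= M then `|derive1 f t| else 0)%:E)%E.
  apply: (@le_trans _ _ (\int[lebesgue_measure]_(t in
    `[Num.min p (l r), Num.max p (l r)]) `|derive1 f t|%:E)%E).
    have -> : tau = `|f (Num.max p (l r)) - f (Num.min p (l r))|.
      by rewrite -hr /h; have [] := leP p (l r) => _ //; rewrite distrC.
    apply: variation_le_integral => [|t /near_p[tab _]|t /near_p[tab _]].
    - by rewrite ge_min !le_max lexx.
    - exact: df.
    - exact: cf.
  apply: ge0_le_integral_sub.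
  - by move=> t /near_p[].
  - by move=> t _; rewrite lee_fin.
  - by move=> t _; case: ifP => _; rewrite lee_fin.
  - by move=> t /near_p[_ ->].
by rewrite leNgt small.
Qed.

(** * The maximum principle *)

(** If the second derivative were positive, the first derivative, which vanishes
    at t, would be positive just after t, and f would increase there by the mean
    value theorem. *)
Lemma second_derivative_at_max (R : realType) (f df : R -> R) (ddf a b t : R) :
  (forall s, s \in `]a, b[ -> is_derive s 1 f (df s)) ->
  t \in `]a, b[ -> is_derive t 1 df ddf ->
  (forall s, s \in `]a, b[ -> f s <= f t) -> ddf <= 0.
Proof.
move=> fdf tab dfd ftmax.
have /andP[at_ tb] : a < t < b by move: tab; rewrite in_itv.
have dft0 : df t = 0.
  have dft := fdf t tab.
  have := @derive1_at_max R f a b t (ltW (lt_trans at_ tb))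
    (fun s sab => @ex_derive _ _ _ _ _ _ _ (fdf s sab)) tab ftmax.
  by move=> d0; rewrite -(@derive_val _ _ _ _ _ _ _ dft) derive_val.
rewrite leNgt; apply/negP => ddf0.
have cvgq : h^-1 *: ((df \o shift t) (h *: (1 : R)) - df t) @[h --> 0^'] --> ddf.
  by rewrite -(@derive_val _ _ _ _ _ _ _ dfd); exact: ex_derive.
have := cvgr_gt ddf cvgq 0 ddf0.
rewrite near_withinE => -[/= e /= e0 He].
pose d := Num.min (e / 2) ((b - t) / 2).
have d0 : 0 < d by rewrite lt_min !divr_gt0 ?subr_gt0.
have de : d < e by rewrite gt_min; apply/orP; left; rewrite ltr_pdivrMr// ltr_pMr// ltr1n.
have dbt : t + d < b.
  have : d <= (b - t) / 2 by rewrite /d ge_min lexx orbT.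
  lra.
have ttd : t < t + d by rewrite ltrDl.
have tdsub s : s \in `[t, t + d] -> s \in `]a, b[.
  rewrite !in_itv /= => /andP[ts sd].
  by rewrite (lt_le_trans at_ ts) (le_lt_trans sd dbt).
have fd s : s \in `]t, t + d[ -> is_derive s 1 f (df s).
  by move=> std; apply/fdf/tdsub/subset_itv_oo_cc.
have cf : {within `[t, t + d], continuous f}.
  apply: continuous_in_subspaceT => s /set_mem std.
  apply: differentiable_continuous; apply/derivable1_diffP.
  exact: (@ex_derive _ _ _ _ _ _ _ (fdf s (tdsub s std))).
have [c cin cE] := MVT ttd fd cf.
move: cin; rewrite in_itv /= => /andP[tc ctd].
have ct0 : 0 < c - t by rewrite subr_gt0.
have cte : `|0 - (c - t)| < e.
  by rewrite sub0r normrN gtr0_norm//; apply: lt_trans de; lra.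
have ctn0 : c - t != 0 by rewrite gt_eqF.
have := He (c - t) cte ctn0; rewrite /= dft0 subr0 /shift /= /GRing.scale /= mulr1 subrK => pos.
have dfc : 0 < df c by move: pos; rewrite pmulr_rgt0// invr_gt0.
have tdab : t + d \in `]a, b[ by rewrite in_itv /= dbt andbT; lra.
by have := ftmax _ tdab; apply/negP; rewrite -ltNge -subr_gt0 cE mulr_gt0// addrC addKr.
Qed.

(** The partial derivatives of a function on the plane are the derivatives of
    its restrictions to rows and columns, because the increments agree. *)
Lemma row_step (R : realType) (h x y : R) :
  h *: ((1, 0) : R * R) + (x, y) = (h *: (1 : R) + x, y).
Proof. by congr (_, _); rewrite /= /GRing.scale /= mulr0 add0r. Qed.

Lemma column_step (R : realType) (h x y : R) :
  h *: ((0, 1) : R * R) + (x, y) = (x, h *: (1 : R) + y).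
Proof. by congr (_, _); rewrite /= /GRing.scale /= mulr0 add0r. Qed.

Lemma derivable_row (R : realType) (u : R * R -> R) (x y : R) :
  derivable u (x, y) (1, 0) -> derivable (fun t => u (t, y)) x 1.
Proof.
rewrite /derivable => du; apply: cvgP; apply: cvg_trans du.
apply: near_eq_cvg; near=> h; rewrite /= row_step.
Unshelve. all: by end_near. Qed.

Lemma derive1_row (R : realType) (u : R * R -> R) (x y : R) :
  derive1 (fun t => u (t, y)) x = partial1 u (x, y).
Proof.
rewrite derive1E /partial1 /derive.
by rewrite [X in lim (X @ _) = _](_ : _ = fun h : R => h^-1 *:
  ((u \o shift (x, y)) (h *: (1, 0)) - u (x, y)))//; apply/funext => h;
  rewrite /= row_step.
Qed.

Lemma derivable_column (R : realType) (u : R * R -> R) (x y : R) :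
  derivable u (x, y) (0, 1) -> derivable (fun t => u (x, t)) y 1.
Proof.
rewrite /derivable => du; apply: cvgP; apply: cvg_trans du.
apply: near_eq_cvg; near=> h; rewrite /= column_step.
Unshelve. all: by end_near. Qed.

Lemma derive1_column (R : realType) (u : R * R -> R) (x y : R) :
  derive1 (fun t => u (x, t)) y = partial2 u (x, y).
Proof.
rewrite derive1E /partial2 /derive.
by rewrite [X in lim (X @ _) = _](_ : _ = fun h : R => h^-1 *:
  ((u \o shift (x, y)) (h *: (0, 1)) - u (x, y)))//; apply/funext => h;
  rewrite /= column_step.
Qed.

(** The constant K is the part of the paraboloid that does not vary along the
    line. *)
Lemma second_derivative_touching_parabola (R : realType) (g : R -> R)
    (a b t x0 K : R) :
  (forall s, s \in `]a, b[ -> derivable g s 1) ->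
  t \in `]a, b[ -> derivable (derive1 g) t 1 ->
  (forall s, s \in `]a, b[ ->
     g s - ((s - x0) ^+ 2 + K) / 8 <= g t - ((t - x0) ^+ 2 + K) / 8) ->
  derive1 (derive1 g) t <= 1 / 4.
Proof.
move=> dg tab ddg gmax; rewrite -subr_le0.
apply: (@second_derivative_at_max R (fun s => g s - ((s - x0) ^+ 2 + K) / 8)
  (fun s => derive1 g s - (s - x0) / 4) _ a b t _ tab _ gmax).
- move=> s sab; have dgs : is_derive s 1 g (derive1 g s).
    by apply: DeriveDef; [exact: dg|rewrite derive1E].
  apply: is_derive_eq; rewrite /GRing.scale /=; by field.
- have dgs : is_derive t 1 (derive1 g) (derive1 (derive1 g) t).
    by apply: DeriveDef; [|rewrite derive1E].
  apply: is_derive_eq; rewrite /GRing.scale /=; by field.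
Qed.

(** The function u - |. - (x0, y0)|^2 / 8 has Laplacian at least 1 - 1/2 > 0,
    so its maximum over the closed rectangle cannot be interior, where both pure
    second derivatives would be nonpositive.  It is therefore attained on the
    frame, and comparing with the value at (x0, y0) gives the quadratic gain. *)
Lemma rectangle_maximum_principle (R : realType) (u : R * R -> R)
    (a b c d x0 y0 : R) (U : set (R * R)) :
  `[a, b]%classic `*` `[c, d]%classic `<=` U ->
  C2 U u ->
  (forall z, U z -> {for z, continuous u}) ->
  (forall z, U z -> 1 <= laplacian u z) ->
  x0 \in `]a, b[ -> y0 \in `]c, d[ ->
  exists x y, [/\ x \in `[a, b], y \in `[c, d],
    x = a \/ x = b \/ y = c \/ y = d &
    u (x0, y0) + ((x - x0) ^+ 2 + (y - y0) ^+ 2) / 8 <= u (x, y)].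
Proof.
move=> abcdU [C1u C1u1 C1u2] cu lap x0ab y0cd.
pose K : set (R * R) := `[a, b]%classic `*` `[c, d]%classic.
pose w z := u z - ((z.1 - x0) ^+ 2 + (z.2 - y0) ^+ 2) / 8.
have K0 : K (x0, y0) by split; apply: subset_itv_oo_cc.
have cK : compact K by apply: compact_setX; exact: segment_compact.
have cw : {within K, continuous w}.
  apply: continuous_in_subspaceT => z /set_mem Kz.
  apply: cvgB; first exact/cu/abcdU.
  apply: cvgMl; apply: cvgD; rewrite expr2.
    by apply: cvgM; (apply: cvgB; [exact: cvg_fst|exact: cvg_cst]).
  by apply: cvgM; (apply: cvgB; [exact: cvg_snd|exact: cvg_cst]).
have [[x y] /set_mem [xab ycd] wmax] :=
  compact_EVT_max (ex_intro _ _ K0) cK cw.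
rewrite /= in xab ycd.
exists x, y; split => //; last first.
  have := wmax (x0, y0) (mem_set K0); rewrite /w /= !subrr expr0n /=; lra.
apply: contrapT => bd.
have xab' : x \in `]a, b[.
  move: xab; rewrite !in_itv /= !lt_neqAle => /andP[-> ->]; rewrite !andbT.
  apply/andP; split; apply/eqP => e; apply: bd; [by left|by right; left].
have ycd' : y \in `]c, d[.
  move: ycd; rewrite !in_itv /= !lt_neqAle => /andP[-> ->]; rewrite !andbT.
  by apply/andP; split; apply/eqP => e; apply: bd; right; right; [left|right].
have Uxy : U (x, y) by exact: abcdU.
have := lap _ Uxy; rewrite /laplacian.
have h1 : partial1 (partial1 u) (x, y) <= 1 / 4.
  rewrite -derive1_row.
  have -> : (fun t => partial1 u (t, y)) = derive1 (fun t => u (t, y)).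
    by apply/funext => t; rewrite derive1_row.
  apply: (@second_derivative_touching_parabola R _ a b x x0 ((y - y0) ^+ 2)) => //.
  - move=> s sab; apply: derivable_row.
    have Us : U (s, y) by apply: abcdU; split => //; exact: subset_itv_oo_cc.
    by have [d1 _ _ _] := C1u _ Us; exact: d1.
  - rewrite (_ : derive1 _ = fun t => partial1 u (t, y)).
      by apply: derivable_row; have [d1 _ _ _] := C1u1 _ Uxy; exact: d1.
    by apply/funext => t; rewrite derive1_row.
  - move=> s sab; apply: (wmax (s, y)); apply/mem_set; split => //.
    exact: subset_itv_oo_cc.
have h2 : partial2 (partial2 u) (x, y) <= 1 / 4.
  rewrite -derive1_column.
  have -> : (fun t => partial2 u (x, t)) = derive1 (fun t => u (x, t)).
    by apply/funext => t; rewrite derive1_column.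
  apply: (@second_derivative_touching_parabola R _ c d y y0 ((x - x0) ^+ 2)) => //.
  - move=> s scd; apply: derivable_column.
    have Us : U (x, s) by apply: abcdU; split => //; exact: subset_itv_oo_cc.
    by have [_ d2 _ _] := C1u _ Us; exact: d2.
  - rewrite (_ : derive1 _ = fun t => partial2 u (x, t)).
      by apply: derivable_column; have [_ d2 _ _] := C1u2 _ Uxy; exact: d2.
    by apply/funext => t; rewrite derive1_column.
  - move=> s scd.
    rewrite ![_ + (x - x0) ^+ 2]addrC; apply: (wmax (x, s)); apply/mem_set; split => //.
    exact: subset_itv_oo_cc.
lra.
Qed.

(** * Good and bad lines *)

Section markov_lines.
Context d1 d2 (T1 : measurableType d1) (T2 : measurableType d2) (R : realType).
Variables (m1 : {sigma_finite_measure set T1 -> \bar R})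
          (m2 : {sigma_finite_measure set T2 -> \bar R}).
Variables (A : set T1) (B : set T2) (g : T1 * T2 -> \bar R) (tau : R).
Hypotheses (mA : measurable A) (mB : measurable B).
Hypotheses (mg : measurable_fun (A `*` B) g) (g0 : forall z, (0 <= g z)%E).
Hypothesis tau0 : 0 < tau.

Let G := g \_ (A `*` B).

Let mG : measurable_fun setT G.
Proof. exact: (measurable_restrictT g (measurableX mA mB)).1. Qed.

Let G0 z : (0 <= G z)%E.
Proof. by rewrite /G patchE; case: ifP. Qed.

(** Markov's inequality for the function of y obtained by integrating g along
    the rows; its integral is that of g by Tonelli. *)
Lemma markov_rows :
  let bad := B `&` [set y | (tau%:E <= \int[m1]_(x in A) g (x, y))%E] in
  measurable bad /\ (tau%:E * m2 bad <= \int[m1 \x m2]_(z in A `*` B) g z)%E.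
Proof.
move=> bad; pose H := fubini_G m1 G.
have mH : measurable_fun setT H by exact: measurable_fun_fubini_tonelli_G.
have H0 y : (0 <= H y)%E by apply: integral_ge0 => x _; exact: G0.
have HB y : B y -> H y = (\int[m1]_(x in A) g (x, y))%E.
  move=> By; rewrite /H /fubini_G [RHS]integral_mkcond.
  apply: eq_integral => x _; rewrite /G !patchE.
  have [/set_mem Ax|nAx] := boolP (x \in A).
    by rewrite mem_set.
  by rewrite memNset// => -[/= /mem_set]; rewrite (negbTE nAx).
have HNB y : ~ B y -> H y = 0%E.
  move=> nBy; apply: integral0_eq => x _.
  by rewrite /G patchE memNset// => -[].
have badE : bad = setT `&` [set y | (tau%:E <= `|H y|)%E].
  apply/seteqP; split => [y [By /= h]|y [_ /= h]].
    by split => //=; rewrite gee0_abs// HB.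
  rewrite gee0_abs// in h; have By : B y.
    by apply: contrapT => /HNB E; move: h; rewrite E lee_fin leNgt tau0.
  by split => //=; rewrite -HB.
split.
  by rewrite badE; apply: emeasurable_fun_c_infty => //; exact: measurableT_comp.
rewrite badE (le_trans (le_integral_abse m2 measurableT mH tau0))//.
rewrite [leRHS]integral_mkcond -/G fubini_tonelli2//.
by under eq_integral do rewrite gee0_abs//.
Qed.

Lemma markov_columns :
  let bad := A `&` [set x | (tau%:E <= \int[m2]_(y in B) g (x, y))%E] in
  measurable bad /\ (tau%:E * m1 bad <= \int[m1 \x m2]_(z in A `*` B) g z)%E.
Proof.
move=> bad; pose H := fubini_F m2 G.
have mH : measurable_fun setT H by exact: measurable_fun_fubini_tonelli_F.
have H0 x : (0 <= H x)%E by apply: integral_ge0 => y _; exact: G0.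
have HA x : A x -> H x = (\int[m2]_(y in B) g (x, y))%E.
  move=> Ax; rewrite /H /fubini_F [RHS]integral_mkcond.
  apply: eq_integral => y _; rewrite /G !patchE.
  have [/set_mem By|nBy] := boolP (y \in B).
    by rewrite mem_set.
  by rewrite memNset// => -[/= _ /mem_set]; rewrite (negbTE nBy).
have HNA x : ~ A x -> H x = 0%E.
  move=> nAx; apply: integral0_eq => y _.
  by rewrite /G patchE memNset// => -[].
have badE : bad = setT `&` [set x | (tau%:E <= `|H x|)%E].
  apply/seteqP; split => [x [Ax /= h]|x [_ /= h]].
    by split => //=; rewrite gee0_abs// HA.
  rewrite gee0_abs// in h; have Ax : A x.
    by apply: contrapT => /HNA E; move: h; rewrite E lee_fin leNgt tau0.
  by split => //=; rewrite -HA.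
split.
  by rewrite badE; apply: emeasurable_fun_c_infty => //; exact: measurableT_comp.
rewrite badE (le_trans (le_integral_abse m1 measurableT mH tau0))//.
rewrite [leRHS]integral_mkcond -/G fubini_tonelli1//.
by under eq_integral do rewrite gee0_abs//.
Qed.

End markov_lines.

(** Here v is a partial derivative of u and M = 2 eps.  Only the gradient on the
    set |u| <= M may be charged, because elsewhere |u|^(-alpha) has no useful
    lower bound. *)
Definition capped (R : realType) (u v : R * R -> R) (M : R) (z : R * R) : R :=
  if `|u z| <= M then `|v z| else 0.

Lemma capped_ge0 (R : realType) (u v : R * R -> R) M z : 0 <= capped u v M z.
Proof. by rewrite /capped; case: ifP. Qed.

Lemma measurable_capped (R : realType) (u v : R * R -> R) (M : R) (U : set (R * R)) :
  open U -> (forall z, U z -> {for z, continuous u}) ->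
  (forall z, U z -> {for z, continuous v}) ->
  measurable_fun U (fun z => (capped u v M z)%:E).
Proof.
move=> oU cu cv; apply/measurable_EFinP.
have mU : measurable U by exact: open_measurable_plane.
have mv := continuous_measurable_plane oU cv.
have mu := continuous_measurable_plane oU cu.
apply: measurable_fun_if => //.
- by apply: measurable_fun_ler => //; exact: measurableT_comp.
- apply: (measurable_funS mU); first by move=> ? [].
  exact: measurableT_comp.
Qed.

Lemma continuous_row (R : realType) (v : R * R -> R) (x y : R) :
  {for (x, y), continuous v} -> {for x, continuous (fun t => v (t, y))}.
Proof.
move=> cv; apply: (cvg_comp (fun t : R => (t, y)) v _ cv).
exact: (@cvg_pair R R R (nbhs x) (nbhs x) (nbhs y) _ _ _ id (fun=> y)
  cvg_id (cvg_cst y)).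
Qed.

Lemma continuous_column (R : realType) (v : R * R -> R) (x y : R) :
  {for (x, y), continuous v} -> {for y, continuous (fun t => v (x, t))}.
Proof.
move=> cv; apply: (cvg_comp (fun t : R => (x, t)) v _ cv).
exact: (@cvg_pair R R R (nbhs y) (nbhs x) (nbhs y) _ _ _ (fun=> x) id
  (cvg_cst x) cvg_id).
Qed.

Section lines.
Context (R : realType) (u : R * R -> R) (U : set (R * R)) (M tau : R).
Hypothesis C1u : C1 U u.
Hypothesis tau0 : 0 <= tau.

Lemma row_variation (a b y p q : R) :
  (forall t, t \in `]a, b[ -> U (t, y)) ->
  (\int[lebesgue_measure]_(t in `]a, b[) (capped u (partial1 u) M (t, y))%:E
     < tau%:E)%E ->
  p \in `]a, b[ -> q \in `]a, b[ -> `|u (p, y)| + tau <= M ->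
  `|u (q, y) - u (p, y)| <= tau.
Proof.
move=> rowU small pab qab pM.
apply: (@small_variation R (fun t => u (t, y)) a b tau M p q _ _ pab qab tau0 pM).
- by move=> t /rowU /C1u[d1 _ _ _]; exact: derivable_row d1.
- move=> t /rowU /C1u[_ _ c1 _].
  rewrite (_ : derive1 _ = fun t => partial1 u (t, y)); last first.
    by apply/funext => r; rewrite derive1_row.
  exact: continuous_row c1.
- by under eq_integral do rewrite derive1_row; exact: small.
Qed.

Lemma column_variation (a b x p q : R) :
  (forall t, t \in `]a, b[ -> U (x, t)) ->
  (\int[lebesgue_measure]_(t in `]a, b[) (capped u (partial2 u) M (x, t))%:E
     < tau%:E)%E ->
  p \in `]a, b[ -> q \in `]a, b[ -> `|u (x, p)| + tau <= M ->
  `|u (x, q) - u (x, p)| <= tau.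
Proof.
move=> colU small pab qab pM.
apply: (@small_variation R (fun t => u (x, t)) a b tau M p q _ _ pab qab tau0 pM).
- by move=> t /colU /C1u[_ d2 _ _]; exact: derivable_column d2.
- move=> t /colU /C1u[_ _ _ c2].
  rewrite (_ : derive1 _ = fun t => partial2 u (x, t)); last first.
    by apply/funext => r; rewrite derive1_column.
  exact: continuous_column c2.
- by under eq_integral do rewrite derive1_column; exact: small.
Qed.

End lines.

(** * The estimate in one cell *)

(** The last two hypotheses are used for the first, third and last fifth of the
    cell in each direction: the outer good lines bound a rectangle and the middle
    ones meet at a point (x0, y0) at distance at least s / 5 from its sides.  If
    |u(px, py)| <= e, then u is within 2 tau of u(px, py) both on the frame and
    at (x0, y0), whereas the maximum principle separates the two values by at
    least (s / 5)^2 / 8 = s^2 / 200.  This exceeds 4 tau, which is the origin of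
    the condition 800 tau < s^2. *)
Lemma no_small_value_on_good_lines (R : realType) (u : R * R -> R)
    (U : set (R * R)) (a b s e tau M : R) (good_row good_column : set R) :
  0 < s -> 0 <= tau -> 800 * tau < s ^+ 2 -> e + 2 * tau <= M ->
  `]a, a + s[%classic `*` `]b, b + s[%classic `<=` U ->
  C2 U u -> (forall z, U z -> {for z, continuous u}) ->
  (forall z, U z -> 1 <= laplacian u z) ->
  (forall y p q, good_row y -> p \in `]a, a + s[ -> q \in `]a, a + s[ ->
     `|u (p, y)| + tau <= M -> `|u (q, y) - u (p, y)| <= tau) ->
  (forall x p q, good_column x -> p \in `]b, b + s[ -> q \in `]b, b + s[ ->
     `|u (x, p)| + tau <= M -> `|u (x, q) - u (x, p)| <= tau) ->
  (forall t, 0 <= t <= 4 / 5 * s ->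
     exists2 y, y \in `]b + t, b + t + s / 5[ & good_row y) ->
  (forall t, 0 <= t <= 4 / 5 * s ->
     exists2 x, x \in `]a + t, a + t + s / 5[ & good_column x) ->
  forall px py, px \in `]a, a + s[ -> py \in `]b, b + s[ ->
    good_column px -> good_row py -> e < `|u (px, py)|.
Proof.
move=> s0 tau0 taus eM QU C2u cu lap row col exrow excol px py pxa pyb cpx rpy.
rewrite ltNge; apply/negP => pe.
have near_column x y : good_column x -> x \in `]a, a + s[ -> y \in `]b, b + s[ ->
    `|u (x, y) - u (px, py)| <= 2 * tau.
  move=> cx xa yb.
  have h1 : `|u (x, py) - u (px, py)| <= tau by apply: row => //; lra.
  have n1 : `|u (x, py)| <= `|u (px, py)| + tau.
    rewrite (le_trans _ (lerD (lexx _) h1))//.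
    by rewrite (le_trans _ (ler_normD _ _))// addrC subrK.
  have h2 : `|u (x, y) - u (x, py)| <= tau by apply: col => //; lra.
  rewrite (_ : _ - _ = (u (x, y) - u (x, py)) + (u (x, py) - u (px, py))); last ring.
  by rewrite (le_trans (ler_normD _ _))//; lra.
have near_row x y : good_row y -> x \in `]a, a + s[ -> y \in `]b, b + s[ ->
    `|u (x, y) - u (px, py)| <= 2 * tau.
  move=> ry xa yb.
  have h1 : `|u (px, y) - u (px, py)| <= tau by apply: col => //; lra.
  have n1 : `|u (px, y)| <= `|u (px, py)| + tau.
    rewrite (le_trans _ (lerD (lexx _) h1))//.
    by rewrite (le_trans _ (ler_normD _ _))// addrC subrK.
  have h2 : `|u (x, y) - u (px, y)| <= tau by apply: row => //; lra.
  rewrite (_ : _ - _ = (u (x, y) - u (px, y)) + (u (px, y) - u (px, py))); last ring.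
  by rewrite (le_trans (ler_normD _ _))//; lra.
have [|y1 y1in ry1] := exrow 0; first lra.
have [|y0 y0in ry0] := exrow (2 / 5 * s); first lra.
have [|y2 y2in ry2] := exrow (4 / 5 * s); first lra.
have [|x1 x1in cx1] := excol 0; first lra.
have [|x0 x0in cx0] := excol (2 / 5 * s); first lra.
have [|x2 x2in cx2] := excol (4 / 5 * s); first lra.
move: y1in y0in y2in x1in x0in x2in; rewrite !in_itv /=.
move=> /andP[y1l y1r] /andP[y0l y0r] /andP[y2l y2r].
move=> /andP[x1l x1r] /andP[x0l x0r] /andP[x2l x2r].
have xsub x : x \in `[x1, x2] -> x \in `]a, a + s[.
  by rewrite !in_itv /= => /andP[? ?]; lra.
have ysub y : y \in `[y1, y2] -> y \in `]b, b + s[.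
  by rewrite !in_itv /= => /andP[? ?]; lra.
have KU : `[x1, x2]%classic `*` `[y1, y2]%classic `<=` U.
  by move=> [x y] [/= /xsub xa /ysub yb]; apply: QU.
have [x [y [xin yin frame]]] := @rectangle_maximum_principle R u x1 x2 y1 y2 x0 y0 U
  KU C2u cu lap ltac:(rewrite in_itv /=; lra) ltac:(rewrite in_itv /=; lra).
have xa := xsub _ xin; have yb := ysub _ yin.
have uxy : `|u (x, y) - u (px, py)| <= 2 * tau.
  case: frame => [xE|[xE|[yE|yE]]].
  - by apply: near_column => //; rewrite xE.
  - by apply: near_column => //; rewrite xE.
  - by apply: near_row => //; rewrite yE.
  - by apply: near_row => //; rewrite yE.
have ux0 : `|u (x0, y0) - u (px, py)| <= 2 * tau.
  by apply: near_column => //; rewrite in_itv /=; lra.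
have far : (s / 5) ^+ 2 <= (x - x0) ^+ 2 + (y - y0) ^+ 2.
  have gx1 : s / 5 <= x0 - x1 by clear -x1r x0l; lra.
  have gx2 : s / 5 <= x2 - x0 by clear -x2l x0r; lra.
  have gy1 : s / 5 <= y0 - y1 by clear -y1r y0l; lra.
  have gy2 : s / 5 <= y2 - y0 by clear -y2l y0r; lra.
  have s5 : 0 <= s / 5 by rewrite divr_ge0// ltW.
  have sq1 (t : R) : s / 5 <= t -> (s / 5) ^+ 2 <= t ^+ 2.
    by move=> st; rewrite ler_sqr ?nnegrE// (le_trans s5).
  case: frame => [->|[->|[->|->]]].
  - by rewrite -[x1 - x0]opprB sqrrN ler_wpDr ?sqr_ge0// sq1.
  - by rewrite ler_wpDr ?sqr_ge0// sq1.
  - by rewrite -[y1 - y0]opprB sqrrN ler_wpDl ?sqr_ge0// sq1.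
  - by rewrite ler_wpDl ?sqr_ge0// sq1.
move: uxy ux0; rewrite !ler_norml => /andP[_ h1] /andP[h2 _] h3.
have sE : (s / 5) ^+ 2 = s ^+ 2 / 25 by field.
rewrite sE in far; clear -h1 h2 h3 far taus; lra.
Qed.

Section cell.
Context (R : realType) (u : R * R -> R) (U : set (R * R)).
Variables (a b s e tau M : R).
Hypotheses (s0 : 0 < s) (tau0 : 0 < tau) (taus : 800 * tau < s ^+ 2)
  (eM : e + 2 * tau <= M).
Let A : set R := `]a, a + s[%classic.
Let B : set R := `]b, b + s[%classic.
Hypothesis QU : A `*` B `<=` U.
Hypotheses (C2u : C2 U u) (cu : forall z, U z -> {for z, continuous u}).
Hypothesis lap : forall z, U z -> 1 <= laplacian u z.

Let F1 z := (capped u (partial1 u) M z)%:E.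
Let F2 z := (capped u (partial2 u) M z)%:E.

Let lebesgue_itv_oo (x l : R) : 0 < l ->
  lebesgue_measure `]x, (x + l)%R[%classic = l%:E.
Proof.
move=> l0; rewrite lebesgue_measure_itv /= lte_fin ltrDl l0 -EFinD.
by congr EFin; rewrite addrC addKr.
Qed.

Let avoid (Bad : set R) (c t : R) : measurable Bad ->
  (lebesgue_measure Bad < (s / 5)%:E)%E ->
  exists2 y, y \in `]c + t, c + t + s / 5[ & ~ Bad y.
Proof.
move=> mBad small; apply: contrapT => none.
have s5 : 0 < s / 5 by rewrite divr_gt0.
suff : ((s / 5)%:E <= lebesgue_measure Bad)%E by rewrite leNgt small.
rewrite -(lebesgue_itv_oo (c + t) s5); apply: le_measure; rewrite ?inE//.
by move=> y yin; apply: contrapT => nBad; apply: none; exists y.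
Qed.

(** The area is at most that of the bad rows and columns, unless one of the
    families fills a fifth of the cell; the factor 5 absorbs the latter case. *)
Lemma cell_estimate :
  (lebesgue2 ((A `*` B) `&` [set z | (`|u z| <= e)%R]) <=
   (5 * s / tau)%:E *
     (\int[lebesgue2]_(z in A `*` B) F1 z +
      \int[lebesgue2]_(z in A `*` B) F2 z))%E.
Proof.
have [C1u _ _] := C2u.
have mA : measurable A by exact: measurable_itv.
have mB : measurable B by exact: measurable_itv.
have oQ : open (A `*` B) by apply: open_setX; exact: itv_open.
have mQ : measurable (A `*` B) by exact: measurableX.
have cuQ z : (A `*` B) z -> {for z, continuous u} by move=> /QU; exact: cu.
have mF1 : measurable_fun (A `*` B) F1.
  by apply: measurable_capped => // z /QU /C1u[_ _ c1 _]; exact: c1.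
have mF2 : measurable_fun (A `*` B) F2.
  by apply: measurable_capped => // z /QU /C1u[_ _ _ c2]; exact: c2.
have F10 z : (0 <= F1 z)%E by rewrite lee_fin capped_ge0.
have F20 z : (0 <= F2 z)%E by rewrite lee_fin capped_ge0.
have [mBr] := @markov_rows _ _ _ _ R lebesgue_measure lebesgue_measure A B F1 tau
  mA mB mF1 F10 tau0.
have [mBc] := @markov_columns _ _ _ _ R lebesgue_measure lebesgue_measure A B F2 tau
  mA mB mF2 F20 tau0.
set Br := B `&` _ in mBr *; set Bc := A `&` _ in mBc *.
pose D1 : \bar R := (\int[lebesgue2]_(z in A `*` B) F1 z)%E.
pose D2 : \bar R := (\int[lebesgue2]_(z in A `*` B) F2 z)%E.
move=> hc hr; change (lebesgue2 ((A `*` B) `&` [set z | (`|u z| <= e)%R])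
  <= (5 * s / tau)%:E * (D1 + D2))%E.
have D10 : (0 <= D1)%E by apply: integral_ge0.
have D20 : (0 <= D2)%E by apply: integral_ge0.
have {}hr : (tau%:E * lebesgue_measure Br <= D1)%E by exact: hr.
have {}hc : (tau%:E * lebesgue_measure Bc <= D2)%E by exact: hc.
clearbody D1 D2; set S := _ `&` _.
have mS : measurable S.
  rewrite (_ : S = (A `*` B) `&` u @^-1` `[- e, e]%classic); last first.
    apply/seteqP; split => z [Qz h]; split => //; move: h;
      by rewrite /= in_itv /= ler_norml.
  have := continuous_measurable_plane oQ cuQ.
  by move=> /(_ mQ _ (measurable_itv `[- e, e])).
have lamA : lebesgue_measure A = s%:E by exact: lebesgue_itv_oo.
have lamB : lebesgue_measure B = s%:E by exact: lebesgue_itv_oo.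
(* bad lines of measure s / 5 already account for the area of the whole cell *)
have whole (beta D : \bar R) : ((s / 5)%:E <= beta)%E -> (tau%:E * beta <= D)%E ->
    (D <= D1 + D2)%E -> (lebesgue2 S <= (5 * s / tau)%:E * (D1 + D2))%E.
  move=> sb bD DD.
  have SQ : (lebesgue2 S <= lebesgue2 (A `*` B))%E.
    by apply: le_measure; rewrite ?inE// => z [].
  apply: (le_trans SQ); rewrite (lebesgue2X mA mB) lamA lamB -EFinM.
  have -> : s * s = 5 * s / tau * (tau * (s / 5)).
    by field; rewrite gt_eqF.
  rewrite EFinM lee_pmul2l ?lte_fin ?divr_gt0 ?mulr_gt0//.
  apply: le_trans DD; apply: le_trans bD.
  by rewrite EFinM lee_pmul2l ?lte_fin.
have [r5|r5] := leP (s / 5)%:E (lebesgue_measure Br).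
  by apply: (whole _ _ r5 hr); rewrite leeDl.
have [c5|c5] := leP (s / 5)%:E (lebesgue_measure Bc).
  by apply: (whole _ _ c5 hc); rewrite leeDr.
have SB : S `<=` (A `*` Br) `|` (Bc `*` B).
  move=> [px py] [[/= Apx Bpy]] pe; apply: contrapT => /not_orP[nBr nBc].
  suff : e < `|u (px, py)| by rewrite ltNge pe.
  apply: (@no_small_value_on_good_lines R u U a b s e tau M
    (fun y => B y /\ ~ Br y) (fun x => A x /\ ~ Bc x) s0 (ltW tau0) taus eM
    QU C2u cu lap) => //.
  - move=> y p q [By nBy] pa qa pM.
    apply: (@row_variation R u U M tau C1u (ltW tau0) a (a + s) y) => //.
      by move=> t ta; apply: QU.
    by rewrite ltNge; apply/negP => h; apply: nBy.
  - move=> x p q [Ax nAx] pb qb pM.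
    apply: (@column_variation R u U M tau C1u (ltW tau0) b (b + s) x) => //.
      by move=> t tb; apply: QU.
    by rewrite ltNge; apply/negP => h; apply: nAx.
  - move=> t t45; have [y yin nBy] := avoid b t mBr r5; exists y => //; split=> //.
    by move: yin; rewrite /B /= !in_itv /= => /andP[y1 y2]; lra.
  - move=> t t45; have [x xin nAx] := avoid a t mBc c5; exists x => //; split=> //.
    by move: xin; rewrite /A /= !in_itv /= => /andP[x1 x2]; lra.
  - by split => // Bx; apply: nBc.
  - by split => // By; apply: nBr.
have mAr := measurableX mA mBr.
have mcB := measurableX mBc mB.
have -> : (5 * s / tau)%:E = (5%:E * ((s / tau)%:E))%E by rewrite -EFinM mulrA.
have st0 : 0 < s / tau by rewrite divr_gt0.
apply: (@le_trans _ _ ((s / tau)%:E * (D1 + D2))%E); last first.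
  rewrite -muleA lee_pemull ?mule_ge0 ?adde_ge0// ?lee_fin ?(ltW st0)//.
  by rewrite ler1n.
apply: (@le_trans _ _ (lebesgue2 (A `*` Br `|` Bc `*` B))).
  by apply: le_measure; rewrite ?inE//; exact: measurableU.
apply: (@le_trans _ _ (lebesgue2 (A `*` Br) + lebesgue2 (Bc `*` B))%E).
  exact: measureU2.
rewrite (lebesgue2X mA mBr) (lebesgue2X mBc mB) lamA lamB ge0_muleDr//.
apply: leeD.
  rewrite [(s / tau)%:E]EFinM -muleA lee_pmul2l ?lte_fin//.
  by rewrite muleC lee_pdivlMr// muleC.
rewrite [leLHS]muleC [(s / tau)%:E]EFinM -muleA lee_pmul2l ?lte_fin//.
by rewrite muleC lee_pdivlMr// muleC.
Qed.
End cell.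

(** * Cutting the square into cells *)

Definition grid_interval (R : realType) (n i : nat) : set R :=
  `]i%:R / n%:R, i%:R / n%:R + n%:R^-1[%classic.

Definition grid_cell (R : realType) (n : nat) (ij : 'I_n * 'I_n) : set (R * R) :=
  @grid_interval R n ij.1 `*` @grid_interval R n ij.2.

Arguments grid_interval : clear implicits.
Arguments grid_cell : clear implicits.

Lemma grid_intervalE (R : realType) (n i : nat) (x : R) : (0 < n)%N ->
  grid_interval R n i x <-> (i%:R < x * n%:R < i.+1%:R).
Proof.
move=> n0; have n0' : 0 < n%:R :> R by rewrite ltr0n.
rewrite /grid_interval /= in_itv /=.
by rewrite -{3}(mul1r n%:R^-1) -mulrDl ltr_pdivrMr// ltr_pdivlMr// -natr1.
Qed.

Lemma grid_interval_inj (R : realType) (n i j : nat) (x : R) : (0 < n)%N ->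
  grid_interval R n i x -> grid_interval R n j x -> i = j.
Proof.
move=> n0 /(grid_intervalE _ _ n0)/andP[i1 i2] /(grid_intervalE _ _ n0)/andP[j1 j2].
have ij : i%:R < j.+1%:R :> R by exact: lt_trans j2.
have ji : j%:R < i.+1%:R :> R by exact: lt_trans i2.
move: ij ji; rewrite !ltr_nat !ltnS => ij ji.
by apply/eqP; rewrite eqn_leq ij ji.
Qed.

Lemma trivIset_grid_cell (R : realType) (n : nat) :
  trivIset setT (grid_cell R n).
Proof.
apply/trivIsetP => -[i j] [i' j'] _ _ ne; apply/seteqP; split => // -[x y].
move=> [[/= xi yj] [/= xi' yj']].
have n0 : (0 < n)%N by apply: leq_ltn_trans (ltn_ord i).
move/eqP: ne; apply; congr (_, _); apply: val_inj => /=.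
  exact: grid_interval_inj xi xi'.
exact: grid_interval_inj yj yj'.
Qed.

Lemma grid_cell_sub (R : realType) (n : nat) ij :
  grid_cell R n ij `<=` open_square.
Proof.
case: ij => i j [x y] [/=].
have n0 : (0 < n)%N by apply: leq_ltn_trans (ltn_ord i).
have n0' : 0 < n%:R :> R by rewrite ltr0n.
have sub (k : 'I_n) (t : R) : grid_interval R n k t -> t \in `]0, 1[.
  move=> /(grid_intervalE _ _ n0)/andP[h1 h2]; rewrite in_itv /=.
  have p : 0 < t * n%:R by apply: le_lt_trans h1; rewrite ler0n.
  rewrite -(pmulr_lgt0 _ n0') p /= -(ltr_pM2r n0') mul1r.
  by apply: (lt_le_trans h2); rewrite ler_nat.
by move=> /sub xi /sub yj; split.
Qed.

Definition grid_coordinates (R : realType) (n : nat) : set R :=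
  [set x | exists k : nat, x = k%:R / n%:R].

Arguments grid_coordinates : clear implicits.

Lemma countable_grid_coordinates (R : realType) n :
  countable (grid_coordinates R n).
Proof.
rewrite (_ : grid_coordinates R n = (fun k : nat => k%:R / n%:R) @` setT).
  by apply: sub_countable (card_image_le _ _) (countableP _).
by apply/seteqP; split => [x [k ->]|x [k _ <-]]; exists k.
Qed.

(** A number t of [0, 1] that is not a multiple of 1/n lies in the open
    interval whose index is the integer part of n t. *)
Lemma square_sub_grid (R : realType) (n : nat) : (0 < n)%N ->
  @square R `<=` \bigcup_(ij in setT) grid_cell R n ij `|`
    (grid_coordinates R n `*` setT `|` setT `*` grid_coordinates R n).
Proof.
move=> n0 [x y] [/= x01 y01].
have n0' : 0 < n%:R :> R by rewrite ltr0n.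
have cut (t : R) : t \in `[0, 1] -> ~ grid_coordinates R n t ->
    exists k : 'I_n, grid_interval R n k t.
  rewrite in_itv /= => /andP[t0 t1] tn.
  have tn0 : 0 <= t * n%:R by rewrite mulr_ge0// ltW.
  have /andP[k1 k2] := truncn_itv tn0; set k := Num.trunc _ in k1 k2.
  have kt : k%:R < t * n%:R.
    rewrite lt_neqAle k1 andbT; apply/eqP => e; apply: tn; exists k.
    by rewrite e mulfK// gt_eqF.
  have kn : (k < n)%N.
    rewrite -(ltr_nat R); apply: (lt_le_trans kt).
    by rewrite ler_piMl// ltW.
  by exists (Ordinal kn); apply/(grid_intervalE _ _ n0); rewrite kt.
have [gx|gx] := pselect (grid_coordinates R n x); first by right; left.
have [gy|gy] := pselect (grid_coordinates R n y); first by right; right.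
have [i xi] := cut x x01 gx; have [j yj] := cut y y01 gy.
by left; exists (i, j).
Qed.

Lemma lebesgue2_grid_lines (R : realType) n :
  measurable (grid_coordinates R n `*` setT `|` setT `*` grid_coordinates R n) /\
  lebesgue2 (grid_coordinates R n `*` setT `|` setT `*` grid_coordinates R n) = 0%E.
Proof.
have cG := @countable_grid_coordinates R n.
set G := grid_coordinates R n in cG *.
have mG : measurable G by apply: countable_measurable.
have G0 : lebesgue_measure G = 0%E by exact: countable_lebesgue_measure0.
have m1 := measurableX mG (@measurableT _ R).
have m2 := measurableX (@measurableT _ R) mG.
split; first exact: measurableU.
apply/eqP; rewrite eq_le measure_ge0 andbT.
apply: (@le_trans _ _ (lebesgue2 (G `*` setT) + lebesgue2 (setT `*` G))%E).
  exact: measureU2.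
rewrite (lebesgue2X mG measurableT) (lebesgue2X measurableT mG).
by rewrite G0 mul0e mule0 adde0.
Qed.

(** * Summation over the cells *)

Definition sublevel (R : realType) (u : R * R -> R) (e : R) : set (R * R) :=
  [set x : R * R | square x /\ (`|u x| <= e)%R].

(** The sublevel set is closed, hence Borel, although u is only controlled on
    the square. *)
Lemma measurable_sublevel (R : realType) (u : R * R -> R) (e : R) :
  {within square, continuous u} -> measurable (sublevel u e).
Proof.
move=> cu.
have : closed (u @^-1` `[- e, e]%classic : set (subspace (@square R))).
  by move/continuous_closedP : cu; apply; exact: itv_closed.
move=> /closed_subspaceP[V cV VE].
have -> : sublevel u e = V `&` square.
  rewrite VE; apply/seteqP; split => x.
    by move=> [sx ux]; split => //; rewrite /= in_itv /= -ler_norml.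
  by move=> [/=]; rewrite in_itv /= -ler_norml.
apply: measurableI; last exact: measurableX.
rewrite -[V]setCK; apply: measurableC; apply: open_measurable_plane.
exact: closed_openC.
Qed.

Lemma open_square_open (R : realType) : open (@open_square R).
Proof. by apply: open_setX; exact: itv_open. Qed.

Lemma continuous_open_square (R : realType) (u : R * R -> R) :
  {within square, continuous u} ->
  forall z, open_square z -> {for z, continuous u}.
Proof.
move=> cu z oz.
have : {within open_square, continuous u}.
  apply: continuous_subspaceW cu => x [x1 x2].
  by split; exact: subset_itv_oo_cc.
rewrite (continuous_open_subspace _ (@open_square_open R)).
by apply; exact: mem_set.
Qed.

Lemma measurable_grid_cell (R : realType) n ij : measurable (grid_cell R n ij).
Proof. by apply: measurableX; exact: measurable_itv. Qed.

Lemma sublevel_le_grid_cells (R : realType) (n : nat) (S : set (R * R)) :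
  (0 < n)%N -> S `<=` square -> measurable S ->
  (lebesgue2 S <= \sum_(ij <- index_enum ('I_n * 'I_n)%type)
     lebesgue2 (grid_cell R n ij `&` S))%E.
Proof.
move=> n0 Ssq mS; set s := index_enum _.
have [mN N0] := @lebesgue2_grid_lines R n.
set N := _ `|` _ in mN N0.
pose cells := \bigcup_(ij in [set` s]) (grid_cell R n ij `&` S).
have mc ij : measurable (grid_cell R n ij `&` S).
  by apply: measurableI => //; exact: measurable_grid_cell.
have mcells : measurable cells.
  by apply: fin_bigcup_measurable => //; exact: finite_seq.
have Scov : S `<=` cells `|` N.
  move=> x Sx; have [[ij _ xij]|] := square_sub_grid n0 (Ssq x Sx); last by right.
  by left; exists ij => //=; rewrite mem_index_enum.
have le1 : (lebesgue2 S <= lebesgue2 (cells `|` N))%E.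
  by apply: le_measure => //; rewrite inE//; exact: measurableU.
apply: (le_trans le1); apply: (@le_trans _ _ (lebesgue2 cells + lebesgue2 N)%E).
  exact: measureU2.
rewrite [X in (_ + X)%E]N0 adde0.
rewrite (fsbig_seq _ _ (index_enum_uniq _)).
by apply: content_sub_fsum => // ij _; exact: mc.
Qed.

Section grid_estimate.
Context (R : realType) (u : R * R -> R) (eps : R) (n : nat).
Hypotheses (cu : {within square, continuous u}) (C2u : C2 open_square u).
Hypothesis lap : forall z, open_square z -> 1 <= laplacian u z.
Hypotheses (n0 : (0 < n)%N) (neps : n%:R^-1 ^+ 2 <= eps).

Let s := index_enum ('I_n * 'I_n)%type.
Let W := \big[setU/set0]_(ij <- s) grid_cell R n ij.
Let F1 z := (capped u (partial1 u) (2 * eps) z)%:E.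
Let F2 z := (capped u (partial2 u) (2 * eps) z)%:E.

Lemma grid_cells_sub : W `<=` open_square.
Proof.
move=> z; rewrite /W -bigcup_seq => -[ij _]; exact: grid_cell_sub.
Qed.

Lemma open_grid_cells : open W.
Proof.
rewrite /W -bigcup_seq; apply: bigcup_open => ij _.
by apply: open_setX; exact: itv_open.
Qed.

Lemma measurable_capped_grid :
  measurable_fun W F1 /\ measurable_fun W F2.
Proof.
have [C1u _ _] := C2u.
have cW z : W z -> {for z, continuous u}.
  by move=> /grid_cells_sub; exact: continuous_open_square.
split; apply: (measurable_capped _ open_grid_cells cW) => z /grid_cells_sub /C1u.
  by move=> [_ _ c1 _]; exact: c1.
by move=> [_ _ _ c2]; exact: c2.
Qed.

(** The cell estimate with s = 1/n, e = eps, M = 2 eps and tau = s^2 / 1000,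
    a choice for which 800 tau < s^2 and e + 2 tau <= M as soon as s^2 <= eps.
    Then 5 s / tau = 5000 n. *)
Lemma grid_estimate :
  (lebesgue2 (sublevel u eps) <= (5000 * n%:R)%:E *
     (\int[lebesgue2]_(z in W) F1 z + \int[lebesgue2]_(z in W) F2 z))%E.
Proof.
have n0' : 0 < n%:R :> R by rewrite ltr0n.
have [mF1 mF2] := measurable_capped_grid.
have F10 z : (0 <= F1 z)%E by rewrite lee_fin capped_ge0.
have F20 z : (0 <= F2 z)%E by rewrite lee_fin capped_ge0.
have mC ij : measurable (grid_cell R n ij) := measurable_grid_cell ij.
have triv : trivIset [set` s] (grid_cell R n).
  by move=> i j _ _; exact: (@trivIset_grid_cell R n i j I I).
have intW F : measurable_fun W F -> (forall z, (0 <= F z)%E) ->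
    (\int[lebesgue2]_(z in W) F z =
     \sum_(ij <- s) \int[lebesgue2]_(z in grid_cell R n ij) F z)%E.
  move=> mF F0; apply: ge0_integral_bigsetU => //; exact: index_enum_uniq.
rewrite (intW F1 mF1 F10) (intW F2 mF2 F20) -big_split /=.
have sub_square : sublevel u eps `<=` square by move=> z [].
apply: (le_trans (sublevel_le_grid_cells n0 sub_square (measurable_sublevel _ cu))).
rewrite ge0_sume_distrr; last first.
  by move=> ij _; apply: adde_ge0; apply: integral_ge0.
apply: lee_sum => ij _.
have cellE : grid_cell R n ij `&` sublevel u eps =
    grid_cell R n ij `&` [set z | (`|u z| <= eps)%R].
  apply/seteqP; split => z [cz uz]; split => //; first by case: uz.
  split => //; have [z1 z2] := grid_cell_sub cz.
  by split; exact: subset_itv_oo_cc.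
rewrite cellE.
have i0 : 0 < n%:R^-1 :> R by rewrite invr_gt0.
have -> : 5000 * n%:R = 5 * n%:R^-1 / (n%:R^-1 ^+ 2 / 1000) :> R.
  by field; rewrite gt_eqF.
have i20 := exprn_gt0 2 i0.
have tau0 : 0 < n%:R^-1 ^+ 2 / 1000 :> R by apply: divr_gt0 i20 _; rewrite ltr0n.
have taus : 800 * (n%:R^-1 ^+ 2 / 1000) < n%:R^-1 ^+ 2 :> R.
  by move: (n%:R^-1 ^+ 2) i20 => r r0; lra.
have eM : eps + 2 * (n%:R^-1 ^+ 2 / 1000) <= 2 * eps.
  by move: (n%:R^-1 ^+ 2) i20 neps => r r0 re; lra.
exact: (cell_estimate i0 tau0 taus eM (@grid_cell_sub R n ij) C2u
  (continuous_open_square cu) lap).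
Qed.

End grid_estimate.

(** * The final estimate *)

(** The case t = 0 relies on the conventions for extended reals: the quotient is
    +oo when g > 0, and 0 when g = 0. *)
Lemma weight_le (R : realType) (g t alpha eps : R) :
  0 <= g -> 0 < alpha -> `|t| <= 2 * eps ->
  ((((2 * eps) `^ alpha)^-1)%:E * g%:E <= g%:E / (`|t| `^ alpha)%:E)%E.
Proof.
move=> g0 a0 te; have e0 : 0 <= 2 * eps by exact: le_trans te.
rewrite inver; case: ifPn => [/eqP t0|t0].
  have [->|g1] := eqVneq g 0; first by rewrite mule0 mul0e.
  by rewrite gt0_muley ?leey// lte_fin lt_neqAle eq_sym g1.
rewrite -!EFinM lee_fin mulrC ler_wpM2l// lef_pV2 ?posrE.
- by apply: ge0_ler_powR => //; rewrite ?nnegrE// ltW.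
- by apply: lt_le_trans (ge0_ler_powR (ltW a0) _ _ te); rewrite ?nnegrE// lt_neqAle eq_sym t0 powR_ge0.
- by rewrite lt_neqAle eq_sym t0 powR_ge0.
Qed.

Lemma partial_le_gradient_norm (R : realType) (u : R * R -> R) z :
  `|partial1 u z| <= gradient_norm u z /\ `|partial2 u z| <= gradient_norm u z.
Proof.
split.
  rewrite -(sqrtr_sqr (partial1 u z)); apply: ler_wsqrtr.
  by rewrite lerDl; exact: sqr_ge0.
rewrite -(sqrtr_sqr (partial2 u z)); apply: ler_wsqrtr.
by rewrite lerDr; exact: sqr_ge0.
Qed.

Definition weighted_gradient_integral (R : realType) (u : R * R -> R) (alpha : R) : \bar R :=
  (\int[lebesgue2]_(x in square)
     ((gradient_norm u x)%:E / (`|u x| `^ alpha)%:E))%E.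

Lemma weighted_gradient_ge0 (R : realType) (u : R * R -> R) (alpha : R) x :
  (0 <= (gradient_norm u x)%:E / (`|u x| `^ alpha)%:E)%E.
Proof.
by apply: mule_ge0; rewrite ?inve_ge0 lee_fin ?sqrtr_ge0 ?powR_ge0.
Qed.

Lemma integral_capped_le (R : realType) (u v : R * R -> R) (W : set (R * R))
    (alpha eps : R) :
  W `<=` square -> measurable W -> 0 < alpha -> 0 < eps ->
  (forall z, `|v z| <= gradient_norm u z) ->
  measurable_fun W (fun z => (capped u v (2 * eps) z)%:E) ->
  (\int[lebesgue2]_(z in W) (capped u v (2 * eps) z)%:E <=
     ((2 * eps) `^ alpha)%:E * weighted_gradient_integral u alpha)%E.
Proof.
move=> Wsq mW a0 e0 vg mF.
have k0 : 0 < (2 * eps) `^ alpha by rewrite powR_gt0// mulr_gt0.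
have F0 z : (0 <= (capped u v (2 * eps) z)%:E)%E by rewrite lee_fin capped_ge0.
rewrite -lee_pdivrMl//.
have -> : (((2 * eps) `^ alpha)^-1%:E *
    \int[lebesgue2]_(z in W) (capped u v (2 * eps) z)%:E =
    \int[lebesgue2]_(z in W) (((2 * eps) `^ alpha)^-1%:E *
       (capped u v (2 * eps) z)%:E))%E.
  by apply/esym/ge0_integralZl_EFin => //; rewrite invr_ge0 ltW.
apply: ge0_le_integral_sub => //.
- by move=> z _; apply: mule_ge0 => //; rewrite lee_fin invr_ge0 ltW.
- by move=> z _; exact: weighted_gradient_ge0.
move=> z Wz; rewrite /capped; case: ifPn => uz; last first.
  by rewrite mule0 weighted_gradient_ge0.
apply: le_trans (weight_le (sqrtr_ge0 _) a0 uz).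
by rewrite -!EFinM lee_fin ler_wpM2l ?invr_ge0 ?(ltW k0)//; exact: vg.
Qed.

Lemma lebesgue2_square (R : realType) : lebesgue2 (@square R) = 1%E.
Proof.
have m01 : measurable (`[0, 1]%classic : set (measurableTypeR R)) := measurable_itv _.
rewrite (lebesgue2X m01 m01) lebesgue_measure_itv /= lte_fin ltr01.
by rewrite -EFinD subr0 mule1.
Qed.

(** The side 1/n has to be at most sqrt eps for the cell estimate, and at least
    sqrt eps / 2 for the constant not to depend on eps. *)
Lemma grid_size (R : realType) (eps : R) : 0 < eps -> eps < 1 ->
  exists n : nat, [/\ (0 < n)%N, n%:R^-1 ^+ 2 <= eps & n%:R <= 2 / Num.sqrt eps].
Proof.
move=> e0 e1; set r := Num.sqrt eps.
have r0 : 0 < r by rewrite sqrtr_gt0.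
have rE : r ^+ 2 = eps by rewrite sqr_sqrtr// ltW.
have r1 : r <= 1 by rewrite -sqrtr1; apply: ler_wsqrtr; exact: ltW.
have ri0 : 0 <= r^-1 by rewrite invr_ge0 ltW.
have /andP[t1 t2] := truncn_itv ri0.
exists (Num.trunc r^-1).+1; split => //.
  rewrite -rE ler_sqr ?nnegrE ?invr_ge0 ?ler0n ?(ltW r0)//.
  by rewrite -[leRHS]invrK lef_pV2 ?posrE ?invr_gt0 ?ltr0n// ltW.
have h1 : 1 <= r^-1 by rewrite invf_ge1.
by rewrite -natr1; lra.
Qed.

Lemma powR_half_bound (R : realType) (alpha eps : R) : 0 < eps ->
  (2 * eps) `^ alpha / Num.sqrt eps <= 2 * (2 * eps) `^ (alpha - 2^-1).
Proof.
move=> e0; have e20 : 0 < 2 * eps by rewrite mulr_gt0.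
have r0 : 0 < Num.sqrt eps by rewrite sqrtr_gt0.
rewrite powRB; last by apply/implyP => _; rewrite gt_eqF.
rewrite powR12_sqrt ?(ltW e20)// mulrCA ler_pM2l ?powR_gt0//.
have q0 : 0 < Num.sqrt (2 * eps) by rewrite sqrtr_gt0.
have qr : Num.sqrt (2 * eps) <= 2 * Num.sqrt eps.
  rewrite -ler_sqr ?nnegrE ?(ltW q0) ?mulr_ge0 ?(ltW r0)//.
  by rewrite exprMn !sqr_sqrtr ?(ltW e0) ?(ltW e20)//; lra.
by rewrite ler_pdivlMr// mulrC ler_pdivrMr.
Qed.

(* The quotient under the integral is taken in the extended reals, so it is
   +oo where u vanishes and the gradient does not, and 0 where both vanish.
   The gradient has no meaning on the (null) boundary of the square. *)
Theorem theorem2 (R : realType) (c : R) :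
  exists C : R, 0 < C /\
    forall u : R * R -> R,
      {within square, continuous u} ->
      C2 open_square u ->
      (forall x : R * R, open_square x -> 1 <= laplacian u x <= c) ->
      forall alpha eps : R, 0 < alpha -> 0 < eps ->
        (lebesgue2 [set x : R * R | square x /\ (`|u x| <= eps)%R]
         <= C%:E * ((Num.sqrt eps)%:E
              + ((2 * eps) `^ (alpha - 2^-1))%:E
                * \int[lebesgue2]_(x in square)
                    ((gradient_norm u x)%:E / (`|u x| `^ alpha)%:E)))%E.
Proof.
(* 5000 n <= 10000 / sqrt eps, two partial derivatives, and a factor 2 from
   [powR_half_bound] *)
have [C CE] : exists C : R, C = 40 * 1000 by exact: (ex_intro _ _ erefl).
have C0 : 0 < C by rewrite CE mulr_gt0 ?ltr0n.
exists C; split=> [//|u cu C2u lapc alpha eps a0 e0].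
have lap z : open_square z -> 1 <= laplacian u z by move=> /lapc/andP[].
change (lebesgue2 (sublevel u eps) <= C%:E * ((Num.sqrt eps)%:E +
  ((2 * eps) `^ (alpha - 2^-1))%:E * weighted_gradient_integral u alpha))%E.
have I0 : (0 <= weighted_gradient_integral u alpha)%E.
  by apply: integral_ge0 => z _; exact: weighted_gradient_ge0.
have r0 : 0 < Num.sqrt eps by rewrite sqrtr_gt0.
have p0 : 0 <= (2 * eps) `^ (alpha - 2^-1) by exact: powR_ge0.
have k0 : 0 <= (2 * eps) `^ alpha by exact: powR_ge0.
have [e1|e1] := leP 1 eps.
  have mS := measurable_sublevel eps cu.
  apply: (@le_trans _ _ (lebesgue2 (@square R))).
    by apply: le_measure; rewrite ?inE//; [exact: measurableX|move=> z []].
  rewrite lebesgue2_square; apply: (@le_trans _ _ (C%:E * (Num.sqrt eps)%:E)%E).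
    rewrite -EFinM lee_fin.
    have : 1 <= Num.sqrt eps by rewrite -[leLHS]sqrtr1; apply: ler_wsqrtr.
    by move: (Num.sqrt eps) => r r1; rewrite CE; lra.
  by rewrite lee_pmul2l// leeDl// mule_ge0.
have [n [n0 neps nle]] := grid_size e0 e1.
apply: (le_trans (grid_estimate cu C2u lap n0 neps)).
have Wsq : \big[setU/set0]_(ij <- index_enum ('I_n * 'I_n)%type) grid_cell R n ij
    `<=` square.
  move=> z /grid_cells_sub[z1 z2]; split; exact: subset_itv_oo_cc.
have mW := open_measurable_plane (@open_grid_cells R n).
have [mF1 mF2] := measurable_capped_grid eps n cu C2u.
have b1 := integral_capped_le Wsq mW a0 e0
  (fun z => (partial_le_gradient_norm u z).1) mF1.
have b2 := integral_capped_le Wsq mW a0 e0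
  (fun z => (partial_le_gradient_norm u z).2) mF2.
have [m mE] : exists m : R, m = 5000 * n%:R by exact: (ex_intro _ _ erefl).
rewrite -mE; have m0 : 0 < m by rewrite mE mulr_gt0 ?ltr0n.
have half := powR_half_bound alpha e0.
set k := (2 * eps) `^ alpha in k0 b1 b2 half *.
set p := (2 * eps) `^ (alpha - 2^-1) in p0 half *.
set J := weighted_gradient_integral u alpha in I0 b1 b2 *.
have mkp : m * (k + k) <= C * p.
  have nk : n%:R * k <= 2 * (k / Num.sqrt eps).
    by rewrite mulrCA mulrC; exact: ler_wpM2l.
  rewrite mE CE -mulrA mulrDr; move: (n%:R * k) (k / _) nk half.
  by clear; move: p => q x y xy yq; lra.
apply: (@le_trans _ _ (C%:E * (p%:E * J))%E); last first.
  by rewrite lee_pmul2l// leeDr// lee_fin ltW.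
apply: (@le_trans _ _ (m%:E * (k%:E * J + k%:E * J))%E).
  by rewrite lee_pmul2l//; exact: leeD b1 b2.
rewrite -ge0_muleDl ?lee_fin// !muleA -EFinD -!EFinM.
by apply: lee_wpmul2r => //; rewrite lee_fin.
Qed.
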